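(* Let $t\ge 1$ and $s\ge 2$ be integers. Then $\chi_p(P_{2t}\Diamond_2 C_{4s+1})\le 4$ if $1\le t\le 3$, and $\chi_p(P_{2t}\Diamond_2 C_{4s+1})\le 5$ if $t\ge 4$. Moreover, equality holds for $t\in\{1,2,3\}$.
   Context: A packing $k$-coloring of a graph $H$ is a map $c:V(H)\to\{1,\ldots,k\}$ such that any two distinct vertices $u,v$ with $c(u)=c(v)=i$ satisfy $d_H(u,v)\ge i+1$. The packing chromatic number $\chi_p(H)$ is the least such $k$. $P_m$ denotes the path $v_1\cdots v_m$ and $C_n$ the cycle on $n$ vertices. Path-aligned product: for positive integers $\ell\mid m$ and a connected vertex-transitive graph $G$ containing $P_\ell$ as a subgraph, $P_m\Diamond_\ell G$ is formed from the path $P_m=v_1\cdots v_m$ and $m/\ell$ pairwise disjoint copies of $G$, where for each $1\le i\le m/\ell$ the consecutive path vertices $v_{(i-1)\ell+1},\ldots,v_{i\ell}$ are identified, in order, with the vertices of a path $P_\ell$ (i.e. $\ell$ consecutive cycle vertices when $G$ is a cycle) in the $i$-th copy of $G$. *)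

(* Defs.v *)
From HB Require Import structures.
From mathcomp Require Import all_boot.

Set Implicit Arguments.
Unset Strict Implicit.
Unset Printing Implicit Defensive.

Record sgraph := SGraph {
  vertex :> finType;
  edge : rel vertex;
  edge_sym : symmetric edge;
  edge_irrefl : irreflexive edge
}.

Section Distance.
Variable G : sgraph.

Definition has_walk (x y : G) (n : nat) : bool :=
  [exists p : n.-tuple G, path (@edge G) x p && (last x p == y)].

Lemma connect_has_walk (x y : G) :
  connect (@edge G) x y -> exists n, has_walk x y n.
Proof.
case/connectP=> p ep ->; exists (size p).
by apply/existsP; exists (in_tuple p); rewrite ep eqxx.
Qed.

(* [None] stands for an infinite distance. *)
Definition gdist (x y : G) : option nat :=
  if @idP (connect (@edge G) x y) is ReflectT xy
  then Some (ex_minn (connect_has_walk xy)) else None.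

Definition gdist_ge (n : nat) (x y : G) : bool :=
  if gdist x y is Some d then n <= d else true.

End Distance.

Section PackingColoring.
Variable G : sgraph.

(* The colours 1, ..., k are the nonzero elements of 'I_k.+1. *)
Definition packing_coloring (k : nat) (c : {ffun G -> 'I_k.+1}) : bool :=
  [forall v, 1 <= c v] &&
  [forall u, forall v, (u != v) && (c u == c v) ==> gdist_ge (c u).+1 u v].

Definition packing_colorable (k : nat) : bool :=
  [exists c : {ffun G -> 'I_k.+1}, packing_coloring c].

Lemma packing_colorable_card : exists k, packing_colorable k.
Proof.
exists #|G|; apply/existsP; exists [ffun v => lift ord0 (enum_rank v)].
apply/andP; split; first by apply/forallP=> v; rewrite ffunE.
apply/forallP=> u; apply/forallP=> v; apply/implyP=> /andP[/eqP uv /eqP].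
by rewrite !ffunE => /lift_inj /enum_rank_inj.
Qed.

Definition packing_chromatic_number : nat := ex_minn packing_colorable_card.

End PackingColoring.

(* [embedding H G] is a copy of H as a (not necessarily induced) subgraph
   of G. *)
Record embedding (H G : sgraph) := Embedding {
  emb :> H -> G;
  emb_inj : injective emb;
  emb_edge : forall x y, edge x y -> edge (emb x) (emb y)
}.

Section PathGraph.
Variable m : nat.

Definition path_edge (i j : 'I_m) : bool := (j == i.+1 :> nat) || (i == j.+1 :> nat).

Lemma path_edge_sym : symmetric path_edge.
Proof. by move=> i j; rewrite /path_edge orbC. Qed.

Lemma path_edge_irrefl : irreflexive path_edge.
Proof. by move=> i; rewrite /path_edge orbb ltn_eqF. Qed.

Definition path_graph : sgraph := SGraph path_edge_sym path_edge_irrefl.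

End PathGraph.

Section CycleGraph.
Variable n : nat.

(* This is the cycle C_n for n >= 3; the conjunct [i != j] only matters for
   n = 1. *)
Definition cycle_edge (i j : 'I_n) : bool :=
  (i != j) && ((j == i.+1 %% n :> nat) || (i == j.+1 %% n :> nat)).

Lemma cycle_edge_sym : symmetric cycle_edge.
Proof. by move=> i j; rewrite /cycle_edge eq_sym orbC. Qed.

Lemma cycle_edge_irrefl : irreflexive cycle_edge.
Proof. by move=> i; rewrite /cycle_edge eqxx. Qed.

Definition cycle_graph : sgraph := SGraph cycle_edge_sym cycle_edge_irrefl.

End CycleGraph.

Section PathAlignedProduct.
Variables (m l : nat) (G : sgraph).

(* [w i] is the path P_l chosen in the i-th copy of G. For l dividing m every
   vertex of P_m is identified with a vertex of some copy, so the vertices of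
   the product are the pairs (copy, vertex of G). *)
Variable w : 'I_(m %/ l) -> embedding (path_graph l) G.

Let vert : finType := ('I_(m %/ l) * G)%type.

(* Counting from 0, v_j is identified with the (j mod l)-th vertex of the path
   chosen in copy j / l. *)
Definition identified (j : path_graph m) (x : vert) : bool :=
  (x.1 == j %/ l :> nat) &&
  [exists r : path_graph l, (r == j %% l :> nat) && (x.2 == w x.1 r)].

Definition pap_edge (x y : vert) : bool :=
  (x.1 == y.1) && edge x.2 y.2 ||
  [exists j : path_graph m, exists k : path_graph m,
    [&& edge j k, identified j x & identified k y]].

Lemma pap_edge_sym : symmetric pap_edge.
Proof.
move=> x y; rewrite /pap_edge eq_sym edge_sym; congr (_ || _).
by apply/idP/idP=> /existsP[j /existsP[k /and3P[jk jx ky]]];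
  apply/existsP; exists k; apply/existsP; exists j; rewrite edge_sym jk jx ky.
Qed.

Lemma pap_edge_irrefl : irreflexive pap_edge.
Proof.
move=> x; rewrite /pap_edge edge_irrefl andbF orFb.
apply: negbTE; apply/negP=> /existsP[j /existsP[k /and3P[jk]]].
case/andP=> /eqP xj /existsP[r /andP[/eqP rj /eqP xr]].
case/andP=> /eqP xk /existsP[q /andP[/eqP qk /eqP xq]].
have rq : r = q by apply: (@emb_inj _ _ (w x.1)); rewrite -xr -xq.
have jkE : j = k.
  by apply: val_inj; rewrite /= (divn_eq j l) (divn_eq k l) -xj -xk -rj -qk rq.
by rewrite jkE edge_irrefl in jk.
Qed.

Definition path_aligned_product : sgraph := SGraph pap_edge_sym pap_edge_irrefl.

End PathAlignedProduct.

Arguments path_aligned_product : clear implicits.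

(* Main.v *)
Require Import Defs.
From mathcomp Require Import all_boot zify.

(** Number the vertices of each cycle 0, 1, ..., 4s so that the chosen edge is
    01; consecutive copies are then joined by an edge from 1 to the next 0.
    Inserting one vertex into C_{4s}, coloured periodically by 1213, gives
    colourings of C_{4s+1}.  Even copies receive 1213 4 1213 1213 ... and odd
    copies 1 * 213 1213 ..., where * is alternately 4 and 5; the colour 5 first
    occurs in the fourth copy.  Conversely, a colouring of C_{4s+1} with colours
    1, 2, 3 would be 4-periodic, and 4 is coprime to 4s+1. *)

Section GraphDistance.
Variable G : sgraph.
Implicit Types x y : G.

Lemma gdist_ge_walk n d x y : gdist_ge n x y -> has_walk x y d -> n <= d.
Proof.
rewrite /gdist_ge /gdist => + xy_d; case: {-}_ / idP => [xy | nxy _].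
  by case: ex_minnP => m _ m_min /leq_trans -> //; apply: m_min.
case: nxy; case/existsP: xy_d => p /andP[ep /eqP <-].
by apply/connectP; exists p.
Qed.

Lemma gdist_ge_lipschitz (f : G -> nat) x y n :
  f x = 0 -> (forall u v, edge u v -> f v <= (f u).+1) -> n <= f y ->
  gdist_ge n x y.
Proof.
move=> fx0 f_lip n_le; rewrite /gdist_ge /gdist.
case: {-}_ / idP => // xy; case: ex_minnP => m /existsP[p /andP[ep /eqP yE]] _.
have walk_le q u : path (@edge G) u q -> f (last u q) <= f u + size q.
  elim: q u => [|v q IHq] u /=; first by rewrite addn0.
  by case/andP=> /f_lip uv /IHq /leq_trans -> //; rewrite addnS -addSn leq_add2r.
by have := walk_le _ _ ep; rewrite yE fx0 size_tuple add0n; apply: leq_trans.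
Qed.

Lemma packing_chromatic_number_le k :
  packing_colorable G k -> packing_chromatic_number G <= k.
Proof.
by move=> Gk; rewrite /packing_chromatic_number; case: ex_minnP => m _; apply.
Qed.

Lemma packing_chromatic_number_ge k :
  (forall j, packing_colorable G j -> k <= j) ->
  k <= packing_chromatic_number G.
Proof.
by move=> Gk; rewrite /packing_chromatic_number; case: ex_minnP => m /Gk.
Qed.

Lemma packing_colorable_nat (c : G -> nat) k :
  (forall v, 1 <= c v <= k) ->
  (forall u v, u != v -> c u = c v -> gdist_ge (c u).+1 u v) ->
  packing_colorable G k.
Proof.
move=> c_bnd c_pack; apply/existsP; exists [ffun v => inord (c v)].
have cE v : (inord (c v) : 'I_k.+1) = c v :> nat.
  by rewrite inordK // ltnS; case/andP: (c_bnd v).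
apply/andP; split.
  by apply/forallP=> v; rewrite ffunE cE; case/andP: (c_bnd v).
apply/forallP=> u; apply/forallP=> v; apply/implyP=> /andP[uv].
by rewrite !ffunE -val_eqE /= !cE => /eqP; apply: c_pack.
Qed.

End GraphDistance.

Definition cyc_dist (n x y : nat) : nat :=
  minn ((x - y) + (y - x)) (n - ((x - y) + (y - x))).

Definition cyc_adj (n x y : nat) : bool :=
  [|| y == x.+1, x == y.+1, (x == 0) && (y == n.-1) | (y == 0) && (x == n.-1)].

Lemma cyc_dist_adj n z x y :
  2 < n -> z < n -> x < n -> y < n ->
  cyc_adj n x y -> cyc_dist n z y <= (cyc_dist n z x).+1.
Proof.
move=> n_gt2 ltz ltx lty; rewrite /cyc_adj /cyc_dist.
by case/or4P=> [/eqP->|/eqP E|/andP[/eqP-> /eqP->]|/andP[/eqP-> /eqP->]]; lia.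
Qed.

Lemma succ_modn n x : x < n -> x.+1 %% n = if x.+1 == n then 0 else x.+1.
Proof.
move=> ltxn; case: eqP => [-> | neq]; first by rewrite modnn.
by rewrite modn_small //; lia.
Qed.

Section CyclePosition.
Variables (n : nat) (w : embedding (path_graph 2) (cycle_graph n)).

Let w0 : nat := (w ord0 : 'I_n).
Let w1 : nat := (w ord_max : 'I_n).

(* The numbering of the cycle for which w visits 0 and then 1. *)
Definition cyc_pos (x : cycle_graph n) : nat :=
  let x' : nat := (x : 'I_n) in
  if w1 == w0.+1 %% n
  then (if w0 <= x' then x' - w0 else x' + n - w0)
  else (if x' <= w0 then w0 - x' else w0 + n - x').

Lemma cyc_pos_lt x : cyc_pos x < n.
Proof.
have := ltn_ord (x : 'I_n); have := ltn_ord (w ord0 : 'I_n).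
by rewrite /cyc_pos -/w0; case: ifP => _; case: ifP; lia.
Qed.

Lemma cyc_pos_inj : injective cyc_pos.
Proof.
move=> x y xy; apply: (@ord_inj n); move: xy.
have := ltn_ord (x : 'I_n); have := ltn_ord (y : 'I_n).
have := ltn_ord (w ord0 : 'I_n).
by rewrite /cyc_pos -/w0; case: ifP => _; case: ifP; case: ifP; lia.
Qed.

Lemma cyc_pos_edge x y :
  2 < n -> edge x y -> cyc_adj n (cyc_pos x) (cyc_pos y).
Proof.
move=> n_gt2 /andP[_].
have ltx := ltn_ord (x : 'I_n); have lty := ltn_ord (y : 'I_n).
have := ltn_ord (w ord0 : 'I_n).
rewrite /cyc_adj /cyc_pos -/w0 !(@succ_modn n (_ : 'I_n)) //.
by case: (w1 == _); repeat case: ifP; lia.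
Qed.

Lemma cyc_pos_emb (r : path_graph 2) : 2 < n -> cyc_pos (w r) = (r : 'I_2).
Proof.
move=> n_gt2.
have lt0 := ltn_ord (w ord0 : 'I_n); have lt1 := ltn_ord (w ord_max : 'I_n).
have /andP[_] : edge (w ord0) (w ord_max) by apply: emb_edge.
case: r => [[|[|//]] lt_r2].
  rewrite (_ : Ordinal lt_r2 = ord0); last exact: val_inj.
  by rewrite /cyc_pos -/w0 leqnn subnn; case: ifP.
rewrite (_ : Ordinal lt_r2 = ord_max); last exact: val_inj.
rewrite -/w0 -/w1 in lt0 lt1 *; rewrite /cyc_pos -/w0 -/w1 !succ_modn //=.
by repeat case: ifP; lia.
Qed.

End CyclePosition.

(* Copies are joined by edges from position 1 of copy i to position 0 of
   copy i.+1. *)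
Definition chain_dist (n : nat) (u v : nat * nat) : nat :=
  if u.1 == v.1 then cyc_dist n u.2 v.2
  else if u.1 < v.1
  then cyc_dist n u.2 1 + (2 * (v.1 - u.1)).-1 + cyc_dist n 0 v.2
  else cyc_dist n u.2 0 + (2 * (u.1 - v.1)).-1 + cyc_dist n 1 v.2.

Definition chain_adj (n : nat) (u v : nat * nat) : bool :=
  [|| (u.1 == v.1) && cyc_adj n u.2 v.2,
      [&& v.1 == u.1.+1, u.2 == 1 & v.2 == 0]
    | [&& u.1 == v.1.+1, u.2 == 0 & v.2 == 1]].

Lemma chain_dist_adj n o u v :
  2 < n -> o.2 < n -> u.2 < n -> v.2 < n ->
  chain_adj n u v -> chain_dist n o v <= (chain_dist n o u).+1.
Proof.
case: o u v => [k z] [i x] [j y] /= n_gt2 ltz ltx lty.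
have d01 : cyc_dist n 0 1 = 1 by rewrite /cyc_dist; lia.
have d10 : cyc_dist n 1 0 = 1 by rewrite /cyc_dist; lia.
have d00 a : cyc_dist n a a = 0 by rewrite /cyc_dist; lia.
rewrite /chain_adj /chain_dist /=; case/or3P.
- case/andP=> /eqP <- xy; have lip a := @cyc_dist_adj n a x y n_gt2.
  case: ifP => _; first exact: lip.
  by case: ifP => _; rewrite -addnS leq_add2l; apply: lip => //; lia.
- case/and3P=> /eqP -> /eqP -> /eqP ->.
  by case: (ltngtP k i.+1); case: (ltngtP k i); rewrite ?d00 ?d01 ?d10; lia.
- case/and3P=> /eqP -> /eqP -> /eqP ->.
  by case: (ltngtP k j.+1); case: (ltngtP k j); rewrite ?d00 ?d01 ?d10; lia.
Qed.

Definition special_pos (i : nat) : nat := if odd i then 1 else 4.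

Definition chain_color (v : nat * nat) : nat :=
  let e := special_pos v.1 in
  if v.2 == e then (if v.1 %% 4 == 3 then 5 else 4)
  else nth 1 [:: 1; 2; 1; 3] ((v.2 - (e < v.2)) %% 4).

Lemma chain_color_bounds v : 1 <= chain_color v <= 4 + (v.1 %% 4 == 3).
Proof.
rewrite /chain_color; case: ifP => _; first by case: ifP.
have: (v.2 - (special_pos v.1 < v.2)) %% 4 < 4 by rewrite ltn_pmod.
by case: (_ %% 4) => [|[|[|[|]]]] //=; lia.
Qed.

Lemma chain_colorP v c : chain_color v = c ->
  let e := special_pos v.1 in
  [\/ v.2 = e /\ c = 4 + (v.1 %% 4 == 3),
      [/\ v.2 <> e, (v.2 - (e < v.2)) %% 2 = 0 & c = 1],
      [/\ v.2 <> e, (v.2 - (e < v.2)) %% 4 = 1 & c = 2]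
    | [/\ v.2 <> e, (v.2 - (e < v.2)) %% 4 = 3 & c = 3]].
Proof.
rewrite /chain_color /= => <-; case: eqP => [-> | neq].
  by constructor 1; split=> //; case: ifP.
set q := _ - _.
case qE: (q %% 4) => [|[|[|[|m]]]] /=.
- by constructor 2; split=> //; lia.
- by constructor 3.
- by constructor 2; split=> //; lia.
- by constructor 4.
- lia.
Qed.

Lemma cyc_color_far s i x y :
  2 <= s -> x < 4 * s + 1 -> y < 4 * s + 1 -> x != y ->
  chain_color (i, x) = chain_color (i, y) ->
  chain_color (i, x) < cyc_dist (4 * s + 1) x y.
Proof.
wlog lt_xy : x y / x < y => [IH | s_ge2 _ lty _ xy].
  move=> s_ge2 ltx lty neq xy; have:= neq; rewrite neq_ltn => /orP[lt_xy | lt_yx].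
    exact: IH.
  by rewrite xy /cyc_dist addnC; apply: IH => //; rewrite eq_sym.
have -> : cyc_dist (4 * s + 1) x y = minn (y - x) (4 * s + 1 - (y - x)).
  by rewrite /cyc_dist; lia.
have := chain_colorP _ _ xy.
have := chain_colorP _ _ (erefl (chain_color (i, y))).
rewrite xy /= /special_pos; set e := if _ then _ else _.
have e4 : e = 1 \/ e = 4 by rewrite /e; case: odd; [left | right].
move: (chain_color _) => c.
case=> [[yn ->]|[yn yE ->]|[yn yE ->]|[yn yE ->]];
  case=> [[xn cE]|[xn xE cE]|[xn xE cE]|[xn xE cE]];
  try (by []); try (by move: cE; case: eqP).
- lia.
- by case: e4 => ?; subst e; lia.
- by case: e4 => ?; subst e; lia.
- by case: e4 => ?; subst e; lia.
Qed.

Lemma chain_color_gates s i x :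
  2 <= s -> x < 4 * s + 1 ->
  let c := chain_color (i, x) in
  let d0 := cyc_dist (4 * s + 1) 0 x in
  let d1 := cyc_dist (4 * s + 1) x 1 in
  [\/ c = 1 /\ 1 <= d1,
      [/\ c = 2, 1 + odd i <= d0 & odd i <= d1],
      [/\ c = 3, 1 <= d0 & 2 <= d1]
    | if odd i then (c == 4 + (i %% 4 == 3)) && (1 <= d0)
      else [&& c == 4, 4 <= d0 & 3 <= d1]].
Proof.
move=> s_ge2 ltx; have := chain_colorP _ _ (erefl (chain_color (i, x))).
rewrite /= /special_pos; move: (chain_color _) => c.
case oi: (odd i); case=> [[-> ->]|[xn xE ->]|[xn xE ->]|[xn xE ->]];
  rewrite /cyc_dist.
- by constructor 4; rewrite /=; lia.
- by constructor 1; split=> //; lia.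
- by constructor 2; split=> //; lia.
- by constructor 3; split=> //; lia.
- by constructor 4; rewrite /=; lia.
- by constructor 1; split=> //; lia.
- by constructor 2; split=> //; lia.
- by constructor 3; split=> //; lia.
Qed.

Lemma chain_color_far_lt s u v :
  2 <= s -> u.2 < 4 * s + 1 -> v.2 < 4 * s + 1 -> u.1 < v.1 ->
  chain_color u = chain_color v ->
  chain_color u < chain_dist (4 * s + 1) u v.
Proof.
case: u v => [i x] [j y] /= s_ge2 ltx lty lt_ij xy.
rewrite /chain_dist /= lt_ij ltn_eqF //.
have := chain_color_gates s i x s_ge2 ltx.
have := chain_color_gates s j y s_ge2 lty.
rewrite /= -{}xy.
move: (chain_color _) (cyc_dist _ 0 _) (cyc_dist _ y 1) => c d0y d1y.
move: (cyc_dist _ 0 _) (cyc_dist _ x 1) => d0x d1x.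
case oi: (odd i); case oj: (odd j); rewrite /=;
  case=> [[? ?]|[? ? ?]|[? ? ?]|yH]; case=> [[? ?]|[? ? ?]|[? ? ?]|xH]; lia.
Qed.

Lemma cyc_dist_sym n x y : cyc_dist n x y = cyc_dist n y x.
Proof. by rewrite /cyc_dist addnC. Qed.

Lemma chain_dist_sym n u v : chain_dist n u v = chain_dist n v u.
Proof.
rewrite /chain_dist; case: ltngtP => _.
- by rewrite (cyc_dist_sym _ 1) (cyc_dist_sym _ 0); lia.
- by rewrite (cyc_dist_sym _ 1) (cyc_dist_sym _ 0); lia.
- exact: cyc_dist_sym.
Qed.

Lemma chain_color_far s u v :
  2 <= s -> u.2 < 4 * s + 1 -> v.2 < 4 * s + 1 -> u != v ->
  chain_color u = chain_color v ->
  chain_color u < chain_dist (4 * s + 1) u v.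
Proof.
move=> s_ge2 ltu ltv uv cuv; case: (ltngtP u.1 v.1) => [lt_uv | lt_vu | eq_uv].
- exact: chain_color_far_lt.
- by rewrite cuv chain_dist_sym; apply: chain_color_far_lt.
case: u v eq_uv ltu ltv uv cuv => [i x] [j y] /= <- ltx lty.
by rewrite xpair_eqE eqxx /chain_dist /= eqxx; apply: cyc_color_far.
Qed.

(* Two adjacent vertices avoiding colour 1 leave no colour for the second
   vertex on one of the two sides, so colour 1 alternates; then so do 2 and 3
   on the remaining vertices. *)
Lemma packing3_periodic (c : nat -> nat) :
  (forall z, 1 <= c z <= 3) ->
  (forall z d, 1 <= d <= 3 -> c z = c (z + d) -> c z < d) ->
  forall z, c (z + 6) = c (z + 2).
Proof.
move=> c_bnd c_pack z.
have b d := c_bnd (z + d).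
have p a d : 1 <= d <= 3 -> c (z + a) = c (z + (a + d)) -> c (z + a) < d.
  by rewrite addnA; apply: c_pack.
have one a : c (z + a.+2) = 1 \/ c (z + a.+3) = 1.
  move: (b a) (b a.+1) (b a.+2) (b a.+3) (b a.+4) (b a.+4.+1).
  move: (p a 2 isT) (p a 3 isT) (p a.+1 1 isT) (p a.+1 2 isT) (p a.+2 1 isT).
  move: (p a 1 isT) (p a.+2 2 isT) (p a.+2 3 isT) (p a.+3 1 isT) (p a.+3 2 isT).
  move: (p a.+4 1 isT); rewrite !(addnS, addn0).
  move: (c _) (c _) (c _) (c _) (c _) (c _) => *.
  lia.
move: (b 2) (b 4) (b 6) (p 2 1 isT) (p 3 1 isT) (p 4 1 isT) (p 5 1 isT).
move: (p 2 2 isT) (p 4 2 isT) (one 0) (one 1) (one 2) (one 3).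
rewrite /= !(addnS, addn0).
move: (c _) (c _) (c _) (c _) (c _) => *.
lia.
Qed.

Lemma has_walk_cat (G : sgraph) (x y z : G) d e :
  has_walk x y d -> has_walk y z e -> has_walk x z (d + e).
Proof.
case/existsP=> p /andP[px /eqP py] /existsP[q /andP[qy /eqP qz]].
apply/existsP; exists [tuple of p ++ q].
by rewrite /= cat_path last_cat py px qy qz eqxx.
Qed.

Lemma has_walk_edge (G : sgraph) (x y : G) : edge x y -> has_walk x y 1.
Proof. by move=> xy; apply/existsP; exists [tuple y]; rewrite /= xy eqxx. Qed.

Section PathAlignedCycle.
Variables (t s : nat).
Hypotheses (t_gt0 : 0 < t) (s_ge2 : 2 <= s).
Variable w : 'I_((2 * t) %/ 2) ->
               embedding (path_graph 2) (cycle_graph (4 * s + 1)).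

Let n := 4 * s + 1.
Let G := path_aligned_product (2 * t) 2 (cycle_graph n) w.

Definition pap_pos (v : G) : nat * nat := ((v.1 : nat), cyc_pos n (w v.1) v.2).

Lemma pap_pos_lt v : (pap_pos v).2 < n.
Proof. exact: cyc_pos_lt. Qed.

Lemma pap_pos_inj : injective pap_pos.
Proof.
move=> [i x] [j y] [] /val_inj ij; move: x y; rewrite /= -{}ij => x y.
by move/cyc_pos_inj ->.
Qed.

Lemma pap_pos_edge u v : edge u v -> chain_adj n (pap_pos u) (pap_pos v).
Proof.
have n_gt2 : 2 < n by rewrite /n; lia.
case: u v => [i x] [j y] /orP[/andP[/= /eqP <- xy] | ].
  by rewrite /chain_adj eqxx /= cyc_pos_edge.
case/existsP=> a /existsP[b /and3P[ab]].
case/andP=> /= /eqP ia /existsP[r /andP[/eqP ra /eqP ->]].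
case/andP=> /= /eqP jb /existsP[q /andP[/eqP qb /eqP ->]].
rewrite /pap_pos /chain_adj /cyc_adj /= !cyc_pos_emb // ra qb ia jb.
by move: ab; rewrite /= /path_edge; lia.
Qed.

Lemma pap_packing_colorable k :
  (forall v : G, chain_color (pap_pos v) <= k) -> packing_colorable G k.
Proof.
move=> color_le; apply: (packing_colorable_nat _ (chain_color \o pap_pos)).
  move=> v; rewrite /= color_le andbT.
  by case/andP: (chain_color_bounds (pap_pos v)).
move=> u v neq_uv /= cuv.
apply: (gdist_ge_lipschitz _ (fun v => chain_dist n (pap_pos u) (pap_pos v))).
- by rewrite /chain_dist /cyc_dist eqxx; lia.
- move=> x y /pap_pos_edge xy; apply: chain_dist_adj; rewrite ?pap_pos_lt //.
  by rewrite /n; lia.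
- apply: chain_color_far; rewrite ?pap_pos_lt //.
  by apply: contra neq_uv => /eqP /pap_pos_inj ->.
Qed.

Lemma pap_packing_colorable_ge4 k : packing_colorable G k -> 4 <= k.
Proof.
case/existsP=> c /andP[/forallP c_gt0 /forallP c_pack]; rewrite ltnNge.
apply/negP=> k_le3.
have n_gt0 : 0 < n by rewrite /n; lia.
have i0 : 'I_((2 * t) %/ 2) by apply: (@Ordinal _ 0); lia.
pose v z : G := (i0, (Ordinal (ltn_pmod z n_gt0) : cycle_graph n)).
have v_edge z : edge (v z) (v z.+1).
  rewrite /= /pap_edge eqxx /= /cycle_edge -val_eqE /=.
  have ltz := ltn_pmod z n_gt0.
  have -> : z.+1 %% n = (z %% n).+1 %% n by rewrite -addn1 -modnDml addn1.
  apply/orP; left; rewrite eqxx orTb andbT succ_modn //.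
  by case: ifP; rewrite /n in ltz *; lia.
have v_walk z d : has_walk (v z) (v (z + d)) d.
  elim: d => [|d IHd].
    by apply/existsP; exists [tuple]; rewrite addn0 /= eqxx.
  rewrite addnS -[X in has_walk _ _ X]addn1.
  exact: has_walk_cat (has_walk_edge _ _ _ (v_edge _)).
have v_neq z d : 1 <= d <= 3 -> v z != v (z + d).
  move=> d13; apply/eqP=> [[]] /eqP; rewrite -[X in X %% n]addn0 eqn_modDl.
  by rewrite /n !modn_small; lia.
pose f z : nat := c (v z).
have f_pack z d : 1 <= d <= 3 -> f z = f (z + d) -> f z < d.
  move=> d13 fz; have /forallP/(_ (v (z + d))) := c_pack (v z).
  have -> : c (v z) == c (v (z + d)) by apply/eqP/val_inj.
  by rewrite v_neq //= => /gdist_ge_walk; apply; apply: v_walk.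
have f_bnd z : 1 <= f z <= 3.
  by rewrite c_gt0 /= (leq_trans _ k_le3) // -ltnS ltn_ord.
have f_per z : f (z + 2 + 4 * s) = f (z + 2).
  elim: (s) => [|m IHm]; first by rewrite addn0.
  rewrite -IHm; have := packing3_periodic f f_bnd f_pack (z + 4 * m).
  by rewrite (_ : z + 4 * m + 6 = z + 2 + 4 * m.+1); [rewrite (addnAC z (4 * m)) | lia].
have f_mod z : f (z + n) = f z.
  by congr (nat_of_ord (c (_, _))); apply: val_inj; rewrite /= modnDr.
have := f_pack (0 + 2 + 4 * s) 1 isT.
rewrite f_per -addnA -/n f_mod => /(_ erefl).
by have := f_bnd (0 + 2); lia.
Qed.

End PathAlignedCycle.

Theorem theorem4 (t s : nat) (ht : 1 <= t) (hs : 2 <= s)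
    (w : 'I_((2 * t) %/ 2) ->
           embedding (path_graph 2) (cycle_graph (4 * s + 1))) :
  let chi := packing_chromatic_number
      (path_aligned_product (2 * t) 2 (cycle_graph (4 * s + 1)) w) in
  [/\ 1 <= t <= 3 -> chi <= 4,
      4 <= t -> chi <= 5
    & t \in [:: 1; 2; 3] -> chi = 4].
Proof.
move=> chi.
have chi_le4 : t <= 3 -> chi <= 4.
  move=> t_le3; apply: packing_chromatic_number_le.
  apply: pap_packing_colorable => // v.
  have /andP[_] := chain_color_bounds (pap_pos t s w v).
  by move/leq_trans; apply; have := ltn_ord v.1; rewrite /=; lia.
split.
- by case/andP=> _ /chi_le4.
- move=> _; apply: packing_chromatic_number_le.
  apply: pap_packing_colorable => // v.
  have /andP[_] := chain_color_bounds (pap_pos t s w v).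
  by move/leq_trans; apply; case: (_ == _).
- rewrite !inE => t123; apply/eqP; rewrite eqn_leq chi_le4; last by lia.
  apply: packing_chromatic_number_ge => k.
  exact: pap_packing_colorable_ge4.
Qed.
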